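(* Let $(V,V^+,\Vert\cdot\Vert)$ be a complete order smooth $\infty$-normed space and let $W$ be a closed subspace of $V$. If $W$ is an $M$-ideal in $V$, then $(V/W,(V/W)^+,\Vert\cdot\Vert)$ is an order smooth $\infty$-normed space.
   Context: A cone in a real vector space is a set $C$ with $\lambda x+y\in C$ for $x,y\in C$, $\lambda\ge 0$; it is proper if $C\cap(-C)=\{0\}$. For a cone $V^+$ in $V$, write $x\le y$ if $y-x\in V^+$; $V^+$ is generating if $V=V^+-V^+$. A real normed space $V$ with a cone $V^+$ is an order smooth $\infty$-normed space if $V^+$ is proper, generating and norm closed, and: $(O.\infty.1)$: $u\le v\le w$ implies $\Vert v\Vert\le\max\{\Vert u\Vert,\Vert w\Vert\}$; $(O.\infty.2)$: for every $v\in V$ and $\epsilon>0$ there are $v_1,v_2\in V^+$ with $v=v_1-v_2$ and $\max\{\Vert v_1\Vert,\Vert v_2\Vert\}<\Vert v\Vert+\epsilon$. For a closed subspace $W$, $V/W$ carries the quotient norm and the cone $(V/W)^+=\overline{\varphi_W(V^+)}^{\Vert\cdot\Vert}$ (norm closure), where $\varphi_W:V\to V/W$ is the quotient map. A closed subspace $Y$ of a Banach space $X$ is an $L$-summand if there is a subspace $Y'$ of $X$ with $X=Y\oplus_1 Y'$, i.e. $X$ is the algebraic direct sum of $Y$ and $Y'$ and $\Vert y+y'\Vert=\Vert y\Vert+\Vert y'\Vert$ for all $y\in Y$, $y'\in Y'$. A closed subspace $W$ of a Banach space $V$ is an $M$-ideal if $W^\perp=\{f\in V^*:f|_W=0\}$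 is an $L$-summand in $V^*$. *)

(* Defs.v *)
From HB Require Import structures.
From mathcomp Require Import all_boot all_order all_algebra.
From mathcomp Require Import generic_quotient ring_quotient.
From mathcomp Require Import boolp classical_sets functions reals.
From mathcomp Require Import topology normedtype.

Set Implicit Arguments.
Unset Strict Implicit.
Unset Printing Implicit Defensive.

Import Order.TTheory GRing.Theory Num.Theory.
Import numFieldNormedType.Exports.
Local Open Scope classical_set_scope.
Local Open Scope ring_scope.
Local Open Scope quotient_scope.

Section Cones.
Context {R : realType} {V : lmodType R}.
Implicit Types C : set V.

Definition cone C :=
  forall (l : R) x y, 0 <= l -> C x -> C y -> C (l *: x + y).

Definition proper_cone C := C `&` (-%R @` C) = [set 0].

Definition generating_cone C :=
  forall v, exists v1 v2, [/\ C v1, C v2 & v = v1 - v2].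

Definition cone_le C (x y : V) := C (y - x).

End Cones.

Record order_smooth_infty_normed {R : realType} (V : normedModType R)
    (C : set V) : Prop := {
  osi_cone : cone C ;
  osi_proper : proper_cone C ;
  osi_generating : generating_cone C ;
  osi_closed : closed C ;
  osi_O1 : forall u v w, cone_le C u v -> cone_le C v w ->
    `|v| <= Num.max `|u| `|w| ;
  osi_O2 : forall v (e : R), 0 < e -> exists v1 v2,
    [/\ C v1, C v2, v = v1 - v2 & Num.max `|v1| `|v2| < `|v| + e]
}.

Definition subspace_set {R : realType} {V : lmodType R} (W : set V) :=
  W 0 /\ forall (a : R) x y, W x -> W y -> W (a *: x + y).

Record closed_subspace {R : realType} (V : normedModType R) := ClosedSubspace {
  csub_set :> set V ;
  csub_subspace : subspace_set csub_set ;
  csub_closed : closed csub_set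
}.

Section Quotient.
Context {R : realType} {V : normedModType R} (W : closed_subspace V).

Definition csub_pred : {pred V} := fun x => x \in (W : set V).

Lemma csub_predP x : reflect (csub_set W x) (x \in csub_pred).
Proof. by apply: (iffP idP) => [/set_mem//|/mem_set]. Qed.

Lemma csub_zmod_closed : zmod_closed csub_pred.
Proof.
have [W0 Wl] := csub_subspace W; split; first exact/csub_predP.
move=> x y /csub_predP Wx /csub_predP Wy; apply/csub_predP.
by rewrite addrC -scaleN1r; exact: Wl.
Qed.

HB.instance Definition _ := GRing.isZmodClosed.Build V csub_pred
  csub_zmod_closed.

(* The closedness of W is part of the key so that the quotient seminorm below
   is a norm, and [quotient W] a [normedModType]. *)
Definition quotient : Type := Quotient.quot csub_pred.

HB.instance Definition _ := EqQuotient.on quotient.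
HB.instance Definition _ := Choice.on quotient.
HB.instance Definition _ := GRing.Zmodule.on quotient.

Definition quotient_map (x : V) : quotient := \pi_(quotient) x.

Lemma quotient_mapP x y : quotient_map x = quotient_map y <-> csub_set W (x - y).
Proof.
have e := Quotient.idealrBE csub_pred x y.
by split=> [xy|/csub_predP]; [apply/csub_predP|]; rewrite e => *; exact/eqP.
Qed.

Lemma quotient_map_surj q : exists x, quotient_map x = q.
Proof. by exists (repr q); exact: reprK. Qed.

Lemma quotient_mapD x y : quotient_map (x + y) = quotient_map x + quotient_map y.
Proof. exact: Quotient.pi_add. Qed.

Definition quotient_scale (a : R) (q : quotient) : quotient :=
  quotient_map (a *: repr q).

Lemma quotient_mapZ a x :
  quotient_map (a *: x) = quotient_scale a (quotient_map x).
Proof.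
apply/quotient_mapP; rewrite -scalerBr.
have [W0 Wl] := csub_subspace W.
rewrite -[_ *: _]addr0; apply: Wl => //.
by apply/quotient_mapP; rewrite [RHS]reprK.
Qed.

Fact quotient_scaleA a b q :
  quotient_scale a (quotient_scale b q) = quotient_scale (a * b) q.
Proof.
by have [x <-] := quotient_map_surj q; rewrite -!quotient_mapZ scalerA.
Qed.

Fact quotient_scale1 : left_id 1 quotient_scale.
Proof.
by move=> q; have [x <-] := quotient_map_surj q; rewrite -quotient_mapZ scale1r.
Qed.

Fact quotient_scaleDr : right_distributive quotient_scale +%R.
Proof.
move=> a p q; have [x <-] := quotient_map_surj p.
have [y <-] := quotient_map_surj q.
by rewrite -quotient_mapD -!quotient_mapZ -quotient_mapD scalerDr.
Qed.

Fact quotient_scaleDl q : {morph quotient_scale^~ q : a b / a + b}.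
Proof.
move=> a b; have [x <-] := quotient_map_surj q.
by rewrite -!quotient_mapZ -quotient_mapD scalerDl.
Qed.

HB.instance Definition _ := GRing.Zmodule_isLmodule.Build R quotient
  quotient_scaleA quotient_scale1 quotient_scaleDr quotient_scaleDl.

Fact quotient_map_linear : linear quotient_map.
Proof. by move=> a x y; rewrite quotient_mapD quotient_mapZ. Qed.

HB.instance Definition _ := GRing.isLinear.Build R V quotient _ quotient_map
  quotient_map_linear.

(* inf of `|x| over the coset q *)
Definition quotient_norm (q : quotient) : R :=
  inf [set `|x| | x in quotient_map @^-1` [set q]].

Lemma quotient_norm_le x : quotient_norm (quotient_map x) <= `|x|.
Proof. by apply: ge_inf; [exists 0 => _ [y _ <-] /= | exists x]. Qed.

Lemma quotient_norm_adherent q (e : R) : 0 < e ->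
  exists2 x, quotient_map x = q & `|x| < quotient_norm q + e.
Proof.
move=> e0; have [|_ [x xq <-] xe] := @inf_adherent R
    [set `|x| | x in quotient_map @^-1` [set q]] e e0.
  split; last by exists 0 => _ [y _ <-] /=.
  by have [x xq] := quotient_map_surj q; exists `|x|; exists x.
by exists x.
Qed.

Lemma quotient_norm_ge0 q : 0 <= quotient_norm q.
Proof.
have [x xq] := quotient_map_surj q.
by apply: lb_le_inf; [exists `|x|; exists x | move=> _ [y _ <-] /=].
Qed.

Fact quotient_normD p q :
  quotient_norm (p + q) <= quotient_norm p + quotient_norm q.
Proof.
apply/ler_addgt0Pr => e e0.
have e20 : 0 < e / 2 by rewrite divr_gt0.
have [x <- xe] := quotient_norm_adherent p e20.
have [y <- ye] := quotient_norm_adherent q e20.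
rewrite -quotient_mapD (le_trans (quotient_norm_le _))//.
rewrite (le_trans (ler_normD _ _))// [e]splitr addrACA.
by rewrite lerD// ltW.
Qed.

Lemma quotient_norm_scale_le (a : R) q :
  quotient_norm (a *: q) <= `|a| * quotient_norm q.
Proof.
apply/ler_addgt0Pr => e e0.
have a1 : 0 < `|a| + 1 by rewrite ltr_wpDl.
have d0 : 0 < e / (`|a| + 1) by rewrite divr_gt0.
have [x xq xe] := quotient_norm_adherent q d0.
rewrite -[in leLHS]xq -linearZ (le_trans (quotient_norm_le _))// normrZ.
rewrite (le_trans (ler_wpM2l (normr_ge0 a) (ltW xe)))// mulrDr lerD2l.
rewrite mulrCA -[leRHS]mulr1 ler_wpM2l ?(ltW e0)//.
by rewrite ler_pdivrMr// mul1r lerDl.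
Qed.

Fact quotient_normZ (a : R) q : quotient_norm (a *: q) = `|a| * quotient_norm q.
Proof.
apply/eqP; rewrite eq_le quotient_norm_scale_le/=.
have [->|a0] := eqVneq a 0; first by rewrite normr0 mul0r quotient_norm_ge0.
rewrite -ler_pdivlMl ?normr_gt0// -normfV.
by rewrite -{1}(scalerK a0 q) quotient_norm_scale_le.
Qed.

Fact quotient_norm_eq0 q : quotient_norm q = 0 -> q = 0.
Proof.
have [x <-] := quotient_map_surj q => x0.
rewrite -(linear0 quotient_map); apply/quotient_mapP; rewrite subr0.
have -> : csub_set W x = closure (csub_set W) x by rewrite -(closure_id W).1//; exact: csub_closed.
move=> B /nbhs_ballP[e /= e0 Be].
have [y yx] := quotient_norm_adherent (quotient_map x) e0.
rewrite x0 add0r => ye; exists (x - y); split.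
  by apply/quotient_mapP.
by apply: Be; rewrite -ball_normE/= opprB addrC subrK.
Qed.

HB.instance Definition _ := Lmodule_isNormed.Build R quotient
  quotient_normD quotient_normZ quotient_norm_eq0.

(* [closure] is for the topology of [quotient_norm], the only one on
   [quotient]. *)
Definition quotient_cone (C : set V) : set quotient :=
  closure (quotient_map @` C).

End Quotient.

Arguments quotient_map {R V} W x.
Arguments quotient_cone {R V} W C.

Section Dual.
Context {R : realType} (V : normedModType R).

Definition continuous_linear : {pred V -> R^o} :=
  fun f => `[< linear f /\ continuous f >].

Record dual := Dual { dual_fun :> V -> R^o ;
                      dual_funP : dual_fun \in continuous_linear }.

HB.instance Definition _ := [isSub for dual_fun].
HB.instance Definition _ := [Choice of dual by <:].

Fact continuous_linear_submod : submod_closed continuous_linear.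
Proof.
split.
  apply/asboolP; split; first by move=> a x y; rewrite /= scaler0 addr0.
  by move=> x; exact: cvg_cst.
move=> a f g /asboolP[lf cf] /asboolP[lg cg]; apply/asboolP; split.
  move=> b x y; rewrite !fctE lf lg !scalerDr !scalerA (mulrC a b).
  by rewrite addrACA.
move=> x; apply: cvgD; last exact: cg.
by apply: cvgZr; exact: cf.
Qed.

HB.instance Definition _ := GRing.isSubmodClosed.Build R (V -> R^o)
  continuous_linear continuous_linear_submod.
HB.instance Definition _ := [SubChoice_isSubLmodule of dual by <:].

Definition dual_norm (f : dual) : R :=
  sup [set `|f x| | x in [set x : V | `|x| <= 1]].

Fact dual_linear (f : dual) : linear f.
Proof. by have /asboolP[] := dual_funP f. Qed.

HB.instance Definition _ (f : dual) :=
  GRing.isLinear.Build R V R^o *:%R f (dual_linear f).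

Lemma dual_continuous (f : dual) : continuous f.
Proof. by have /asboolP[] := dual_funP f. Qed.

Lemma dual_ext (f g : dual) : f =1 g -> f = g.
Proof. by move=> fg; apply/val_inj/funext. Qed.

Lemma dual_norm_has_sup (f : dual) :
  has_sup [set `|f x| | x in [set x : V | `|x| <= 1]].
Proof.
split; first by exists `|f 0|; exists 0 => //=; rewrite normr0.
have /linear_bounded_continuous/linear_boundedP/pinfty_ex_gt0[r r0 fr] :=
  @dual_continuous f.
exists r => _ [x /= x1 <-]; rewrite (le_trans (fr x))//.
by rewrite ler_piMr// ltW.
Qed.

Lemma dual_norm_ub (f : dual) x : `|x| <= 1 -> `|f x| <= dual_norm f.
Proof.
by move=> x1; apply: (sup_upper_bound (dual_norm_has_sup f)); exists x.
Qed.

Lemma dual_norm_le (f : dual) c :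
  (forall x, `|x| <= 1 -> `|f x| <= c) -> dual_norm f <= c.
Proof.
move=> fc; apply: ge_sup; first by have [] := dual_norm_has_sup f.
by move=> _ [x /= x1 <-]; exact: fc.
Qed.

Lemma dual_norm_ge0 (f : dual) : 0 <= dual_norm f.
Proof. by rewrite (le_trans (normr_ge0 (f 0)))// dual_norm_ub// normr0. Qed.

Lemma dual_normP (f : dual) x : `|f x| <= dual_norm f * `|x|.
Proof.
have [->|x0] := eqVneq x 0; first by rewrite linear0 !normr0 mulr0.
have nx0 : 0 < `|x| by rewrite normr_gt0.
have := @dual_norm_ub f (`|x|^-1 *: x); rewrite normfZV// => /(_ (lexx _)).
by rewrite linearZ normrZ normfV normr_id ler_pdivrMl// mulrC.
Qed.

Fact dual_normD (f g : dual) : dual_norm (f + g) <= dual_norm f + dual_norm g.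
Proof.
apply: dual_norm_le => x x1; rewrite (le_trans (ler_normD (f x) (g x)))//.
by rewrite lerD// dual_norm_ub.
Qed.

Lemma dual_norm_scale_le (a : R) (f : dual) :
  dual_norm (a *: f) <= `|a| * dual_norm f.
Proof.
apply: dual_norm_le => x x1.
have -> : (a *: f) x = a *: f x by [].
by rewrite normrZ ler_wpM2l// dual_norm_ub.
Qed.

Fact dual_normZ (a : R) (f : dual) : dual_norm (a *: f) = `|a| * dual_norm f.
Proof.
apply/eqP; rewrite eq_le dual_norm_scale_le/=.
have [->|a0] := eqVneq a 0; first by rewrite normr0 mul0r dual_norm_ge0.
rewrite -ler_pdivlMl ?normr_gt0// -normfV.
by rewrite -{1}(scalerK a0 f) dual_norm_scale_le.
Qed.

Fact dual_norm_eq0 (f : dual) : dual_norm f = 0 -> f = 0.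
Proof.
move=> f0; apply: dual_ext => x; apply/eqP; rewrite -normr_le0.
by rewrite (le_trans (dual_normP f x))// f0 mul0r.
Qed.

HB.instance Definition _ := Lmodule_isNormed.Build R dual
  dual_normD dual_normZ dual_norm_eq0.

End Dual.

Section MIdeals.
Context {R : realType}.

(* Stated for any normed space; applied below to the dual, which is always
   complete. *)
Definition Lsummand {X : normedModType R} (Y : set X) :=
  [/\ subspace_set Y, closed Y & exists Y' : set X,
    [/\ subspace_set Y',
        forall x, exists y y', [/\ Y y, Y' y' & x = y + y'],
        Y `&` Y' = [set 0] &
        forall y y', Y y -> Y' y' -> `|y + y'| = `|y| + `|y'|]].

Definition annihilator {V : normedModType R} (W : set V) : set (dual V) :=
  [set f | forall x, W x -> f x = 0].

Definition Mideal {V : normedModType R} (W : closed_subspace V) :=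
  Lsummand (annihilator W).

End MIdeals.

(* Main.v *)
Require Import Defs.
From HB Require Import structures.
From mathcomp Require Import all_boot all_order all_algebra.
From mathcomp Require Import boolp classical_sets functions reals.
From mathcomp Require Import topology normedtype.
From mathcomp Require Import ring lra.

(* By Hahn-Banach, (O.infty.1) on [V] yields for each [f] in the dual of [V] a
   decomposition [f = g - h] with [g, h] positive and [`|g| + `|h| <= `|f|].
   If [f] annihilates [W], then so do [g] and [h]: their components outside the
   L-summand [annihilator W] would be wasted norm. Hence every functional on
   [V / W] is a difference of positive functionals with additive norms, and
   applying this to a norming functional of [v] gives (O.infty.1) on the
   quotient. Properness is (O.infty.1) for [0 <= q <= 0]; the other axioms pass
   to the quotient directly. *)

Set Implicit Arguments.
Unset Strict Implicit.
Unset Printing Implicit Defensive.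

Import Order.TTheory GRing.Theory Num.Theory.
Import numFieldNormedType.Exports.
Local Open Scope classical_set_scope.
Local Open Scope ring_scope.

(** * Hahn-Banach extension for convex cones *)

Section HahnBanach.
Context {R : realType} {V : lmodType R}.
Implicit Types S T : set (V * R^o).

(** [S] stands for the epigraph of a sublinear functional; the last clause keeps its infimum over
    [0] from dropping to minus infinity. *)
Definition epigraph_cone S :=
  [/\ S (0, 0), cone S & forall a, S (0, a) -> 0 <= a].

Lemma cone_scale S (l : R) x a : epigraph_cone S -> 0 <= l ->
  S (x, a) -> S (l *: x, l * a).
Proof.
move=> [S0 Sc _] l0 Sxa; have := Sc _ _ _ l0 Sxa S0.
by rewrite /GRing.add/= /add_pair/= !addr0.
Qed.

Lemma cone_add S x a y b : epigraph_cone S ->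
  S (x, a) -> S (y, b) -> S (x + y, a + b).
Proof.
move=> [_ Sc _] Sxa Syb; have := Sc _ _ _ ler01 Sxa Syb.
by rewrite scale1r.
Qed.

(** Adjoining the ray through [(y, c)] imposes [g y <= c] on a linear [g] lying below the cone. *)
Definition add_ray T (y : V) (c : R) : set (V * R^o) :=
  [set z | exists2 t : R, 0 <= t & T (z.1 - t *: y, z.2 - t * c)].

Lemma sub_add_ray T y c : T `<=` add_ray T y c.
Proof. by move=> [x a] Txa; exists 0; rewrite //= scale0r mul0r !subr0. Qed.

(** A new point over [0] is [t] times [(y, c)] plus a point of [T] over [- (t *: y)]; dividing by
    [t > 0] reduces its sign to the hypothesis. *)
Lemma epigraph_cone_add_ray T y c : epigraph_cone T ->
  (forall a, T (- y, a) -> 0 <= a + c) -> epigraph_cone (add_ray T y c).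
Proof.
move=> ecT yc; have [T0 Tc Tpos] := ecT; split.
- exact: sub_add_ray.
- move=> l [x a] [x' a'] l0 [t t0 /= Tx] [t' t'0 /= Tx'].
  exists (l * t + t'); first by rewrite addr_ge0// mulr_ge0.
  have := Tc _ _ _ l0 Tx Tx'; congr T.
  congr pair => /=; last by rewrite /GRing.scale/=; ring.
  by rewrite scalerBr scalerDl scalerA opprD addrACA.
- move=> a [t t0 /=]; rewrite sub0r.
  have [->|tn0] := eqVneq t 0.
    by rewrite scale0r oppr0 mul0r subr0; exact: Tpos.
  have tp : 0 < t by rewrite lt_neqAle eq_sym tn0.
  have tVp : 0 <= t^-1 by rewrite invr_ge0.
  move=> /(cone_scale ecT tVp); rewrite scalerN scalerK// => /yc.
  by rewrite mulrBr mulKf// subrK pmulr_rge0// invr_gt0.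
Qed.

Lemma epigraph_cone_maximal S : epigraph_cone S ->
  exists T, [/\ epigraph_cone T, S `<=` T &
    forall T', epigraph_cone T' -> T `<=` T' -> T' `<=` T].
Proof.
move=> ecS; have [F FP|X [ecX maxX]] :=
  @Zorn_bigcup _ (fun X => epigraph_cone (S `|` X)); last first.
  exists (S `|` X); split=> // T' ecT' XT' z T'z.
  apply: contrapT => nz; apply: (maxX T').
    split; first by move=> w Xw; apply: XT'; right.
    by move=> T'X; apply: nz; right; exact: T'X.
  by have -> : S `|` T' = T' by apply/setUidPr => w Sw; apply: XT'; left.
move=> Ftot.
(* The cone axioms involve at most two points at once, and any two points of the union already lie
   in a single member. *)
have common z z' : (S `|` \bigcup_(X in F) X) z ->
    (S `|` \bigcup_(X in F) X) z' ->
    exists T,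
      [/\ epigraph_cone T, T z, T z' & T `<=` S `|` \bigcup_(X in F) X].
  have SX X : F X -> S `|` X `<=` S `|` \bigcup_(X in F) X.
    by move=> FX; apply: setUS; exact: bigcup_sup.
  move=> [Sz|[X FX Xz]] [Sz'|[X' FX' Xz']].
  - by exists S; split=> // w; left.
  - by exists (S `|` X'); split; [exact: FP|left|right|exact: SX].
  - by exists (S `|` X); split; [exact: FP|right|left|exact: SX].
  - have [XX'|X'X] := Ftot _ _ FX FX'.
      exists (S `|` X').
      by split; [exact: FP|right; exact: XX'|right|exact: SX].
    exists (S `|` X).
    by split; [exact: FP|right|right; exact: X'X|exact: SX].
split; first by left; case: ecS.
- move=> l z z' l0 /common/[apply] -[T [[_ Tc _] Tz Tz' TS]].
  by apply: TS; exact: Tc.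
- by move=> a az; have [T [[_ _ Tpos] Ta _ _]] := common _ _ az az; exact: Tpos.
Qed.

(* Hahn-Banach with the sublinear functional replaced by a convex cone of
   [V * R] playing the role of its epigraph: a maximal such cone contains the
   graph of a linear functional. *)
Lemma Hahn_Banach_cone S : epigraph_cone S -> (forall x, exists a, S (x, a)) ->
  exists g : V -> R^o, linear g /\ forall x a, S (x, a) -> g x <= a.
Proof.
move=> /epigraph_cone_maximal[T [ecT ST maxT]] Sx.
have [_ _ Tpos] := ecT.
have Tx x : exists a, T (x, a) by have [a /ST] := Sx x; exists a.
(* By maximality, a ray that can be adjoined already lies in [T]. *)
have Tray y (c : R) : (forall a, T (- y, a) -> 0 <= a + c) -> T (y, c).
  move=> yc; apply: (maxT (add_ray T y c)).
  - exact: epigraph_cone_add_ray.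
  - exact: sub_add_ray.
  - by exists 1; rewrite //= scale1r mul1r !subrr; case: ecT.
have Tle x a b : T (x, a) -> T (- x, - b) -> b <= a.
  by move=> Ta /(cone_add ecT Ta); rewrite subrr => /Tpos; rewrite subr_ge0.
(* The fibre over [y] is bounded below by the negated fibre over [- y]; at its infimum [c], both
   [(y, c)] and [(- y, - c)] can be adjoined. *)
have graph y : exists c : R^o, T (y, c) /\ T (- y, - c).
  have lb b : T (- y, b) -> lbound [set a : R | T (y, a)] (- b).
    by move=> Tb a /= /Tle; apply; rewrite opprK.
  have [b0 Tb0] := Tx (- y).
  exists (inf [set a : R | T (y, a)]); split; apply: Tray => a Ta.
    by rewrite -lerBlDl sub0r lb_le_inf//; [exact: Tx|exact: lb].
  rewrite subr_ge0 ge_inf//; first by exists (- b0); exact: lb.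
  by move: Ta; rewrite opprK.
have [g gP] := choice graph.
exists g; split=> [l x y|x a /ST Ta]; last by apply: (Tle x) => //; case: (gP x).
(* Linearity follows by showing that [T] contains both candidate values together with their
   opposites. *)
have Tuniq z a b : T (z, a) -> T (- z, - a) -> T (z, b) -> T (- z, - b) -> a = b.
  by move=> ? ? ? ?; apply/eqP; rewrite eq_le !(Tle z).
have [lx lNx] : T (l *: x, l * g x) /\ T (- (l *: x), - (l * g x)).
  have [gx gNx] := gP x; have [l0|/ltW l0] := leP 0 l.
    by split; [|rewrite -scalerN -mulrN]; exact: (cone_scale ecT).
  rewrite -oppr_ge0 in l0; split.
    by have := cone_scale ecT l0 gNx; rewrite scalerN scaleNr opprK mulrNN.
  by have := cone_scale ecT l0 gx; rewrite scaleNr mulNr.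
have [gy gNy] := gP y; have [gz gNz] := gP (l *: x + y).
apply: (Tuniq (l *: x + y)) => //; first exact: cone_add.
by rewrite !opprD; exact: cone_add.
Qed.

End HahnBanach.

(** * Norming functionals, positive decompositions and L-summands *)

Section DualNormed.
Context {R : realType} {V : normedModType R}.

(** The one-sided bound is enough: applied to [- x], it bounds [g x] from below. *)
Lemma dual_of_bounded (g : V -> R^o) (N : R) : linear g ->
  (forall x, g x <= N * `|x|) -> exists G : dual V, G =1 g.
Proof.
move=> lg gN; pose hg := GRing.isLinear.Build R V R^o *:%R g lg.
pose g' : {linear V -> R^o} := HB.pack g hg.
suff gc : g \in @continuous_linear R V by exists (Dual gc).
apply/asboolP; split=> //.
apply: (@bounded_linear_continuous _ _ _ g').
apply/linear_boundedP; near=> r => x.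
have Nr : N * `|x| <= r * `|x|.
  by rewrite ler_wpM2r//; near: r; exact: nbhs_pinfty_ge (num_real N).
rewrite ler_norml lerNl -[- _](linearN g').
by rewrite !(le_trans (gN _))//= normrN.
Unshelve. all: by end_near. Qed.

Lemma norming_functional (q : V) :
  exists f : dual V, (forall x, f x <= `|x|) /\ f q = `|q|.
Proof.
(* The epigraph of the norm plus the line through [(q, |q|)]: a linear functional below it is
   bounded by the norm and equals [|q|] at [q]. *)
pose S : set (V * R^o) :=
  [set z | exists t : R, `|z.1 + t *: q| - t * `|q| <= z.2].
have ecS : epigraph_cone S.
  split.
  - by exists 0; rewrite /= scale0r mul0r addr0 normr0 subr0.
  - move=> l [x a] [x' a'] l0 [t /= ta] [t' /= ta']; exists (l * t + t') => /=.
    have := ler_wpM2l l0 ta; rewrite mulrBr -{1}(ger0_norm l0) -normrZ => lta.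
    apply: le_trans (lerD lta ta').
    rewrite mulrDl opprD mulrA addrACA lerD2r.
    by rewrite scalerDl scalerDr scalerA addrACA ler_normD.
  - move=> a [t /=]; rewrite add0r normrZ -mulrBl => /(le_trans _); apply.
    by rewrite mulr_ge0// subr_ge0 ler_norm.
have Snorm x : S (x, `|x|) by exists 0; rewrite /= scale0r addr0 mul0r subr0.
have [|g [lg gS]] := Hahn_Banach_cone ecS; first by move=> x; exists `|x|.
have [x|f fg] := @dual_of_bounded g 1 lg; first by rewrite mul1r gS.
have fle x : f x <= `|x| by rewrite fg gS.
exists f; split=> //; apply/eqP; rewrite eq_le fle/=.
have := gS (- q) (- `|q|); rewrite -fg linearN lerN2; apply.
by exists 1; rewrite /= scale1r addNr normr0 mul1r sub0r.
Qed.

(* The norm bound amounts to [g (x + y) <= `|f| max(`|x|, `|y|) + f y], and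
   positivity to [g (- b) <= 0] and [g (- c) <= - f c] for [b, c] in [Vp]; the
   cone [S] below is generated by these constraints. They are compatible since
   [x + y = b + c] gives [- y <= c - y <= x], hence
   [`|c - y| <= max(`|x|, `|y|)]. *)
Lemma dual_decomposition (Vp : set V) (f : dual V) :
  order_smooth_infty_normed Vp ->
  exists g h : dual V, [/\ f = g - h, forall x, Vp x -> 0 <= g x,
    forall x, Vp x -> 0 <= h x & `|g| + `|h| <= `|f|].
Proof.
move=> VpP; have Vpc := osi_cone VpP.
have Vp0 : Vp 0.
  by have : (Vp `&` (-%R @` Vp)) 0 by [rewrite (osi_proper VpP)]; case.
pose S : set (V * R^o) := [set z | exists x y b c,
  [/\ Vp b, Vp c, z.1 = x + y - b - c &
      `|f| * Num.max `|x| `|y| + f y - f c <= z.2] ].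
have SI x y b c : Vp b -> Vp c ->
    S (x + y - b - c, `|f| * Num.max `|x| `|y| + f y - f c).
  by move=> Vb Vc; exists x, y, b, c.
have ecS : epigraph_cone S.
  split.
  - have := SI 0 0 0 0 Vp0 Vp0.
    by rewrite !subr0 addr0 linear0 !normr0 maxxx mulr0 subr0 addr0.
  - move=> l [z1 a1] [z2 a2] l0 [x [y [b [c [Vb Vc /= -> H1]]]]].
    move=> [x' [y' [b' [c' [Vb' Vc' /= -> H2]]]]].
    exists (l *: x + x'), (l *: y + y'), (l *: b + b'), (l *: c + c').
    split; [exact: Vpc|exact: Vpc| |].
      rewrite /= !scalerBr !scalerDr !opprD.
      rewrite [LHS]addrACA; congr (_ + _).
      by rewrite [LHS]addrACA; congr (_ + _); rewrite addrACA.
    rewrite /= !linearP/=; apply: le_trans (lerD (ler_wpM2l l0 H1) H2).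
    set m := Num.max _ _; set m1 := Num.max _ _; set m2 := Num.max _ _.
    have mle : m <= l * m1 + m2.
      rewrite ge_max; apply/andP; split; rewrite (le_trans (ler_normD _ _))//;
        by rewrite normrZ (ger0_norm l0) lerD ?ler_wpM2l// le_max lexx ?orbT.
    have := ler_wpM2l (normr_ge0 f) mle.
    rewrite /GRing.scale/=; lra.
  - move=> a [x [y [b [c [Vb Vc /= xybc]]]]]; apply: le_trans.
    have le1 : `|c - y| <= Num.max `|x| `|y|.
      rewrite maxC -[X in Num.max X _]normrN.
      apply: (osi_O1 VpP); rewrite /cone_le.
        by rewrite opprK subrK.
      suff -> : x - (c - y) = b by [].
      by rewrite opprB addrA -(subr0_eq (esym xybc)) subKr.
    have := le_trans (dual_normP f (c - y)) (ler_wpM2l (normr_ge0 f) le1).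
    by rewrite ler_norml linearB => /andP[_]; lra.
have [|g [lg gS]] := Hahn_Banach_cone ecS.
  move=> x; have := SI x 0 0 0 Vp0 Vp0.
  by rewrite addr0 !subr0; set a := (a in (_, a)); exists a.
have gxy x y : g (x + y) <= `|f| * Num.max `|x| `|y| + f y.
  by apply: gS; have := SI x y 0 0 Vp0 Vp0; rewrite !subr0 linear0 subr0.
have [x|G Gg] := @dual_of_bounded g `|f| lg.
  have := gxy x 0; rewrite addr0 linear0 addr0 normr0.
  by rewrite max_l.
have HE x : (G - f) x = G x - f x by [].
exists G, (G - f); split.
- by rewrite opprB addrC subrK.
- move=> b Vb; have := gS (- b) 0; rewrite -Gg linearN oppr_le0; apply.
  have := SI 0 0 b 0 Vb Vp0.
  by rewrite addr0 subr0 add0r linear0 !normr0 maxxx mulr0 subr0 addr0.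
- move=> c Vc; rewrite HE subr_ge0.
  have := gS (- c) (- f c); rewrite -Gg linearN lerN2; apply.
  have := SI 0 0 0 c Vp0 Vc.
  by rewrite addr0 subr0 sub0r linear0 !normr0 maxxx mulr0 add0r sub0r.
(* Changing the signs of [x] and [y] independently turns the values into absolute values; the
   suprema over [x] and over [y] are then taken separately. *)
- have sum1 x y : `|x| <= 1 -> `|y| <= 1 -> G x + (G - f) y <= `|f|.
    move=> x1 y1; rewrite HE; have := gxy x y; rewrite -Gg linearD.
    have : `|f| * Num.max `|x| `|y| <= `|f|.
      by rewrite ler_piMr// ge_max x1.
    by lra.
  have sum2 x y : `|x| <= 1 -> `|y| <= 1 -> `|G x| + (G - f) y <= `|f|.
    move=> x1 y1; have [_|_] := ger0P (G x); first exact: sum1.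
    by rewrite -(linearN G) sum1// normrN.
  have sum3 x y : `|x| <= 1 -> `|y| <= 1 -> `|G x| + `|(G - f) y| <= `|f|.
    move=> x1 y1; have [_|_] := ger0P ((G - f) y); first exact: sum2.
    by rewrite -(linearN (G - f)) sum2// normrN.
  rewrite -lerBrDr; apply: dual_norm_le => x x1.
  rewrite lerBrDr -lerBrDl; apply: dual_norm_le => y y1.
  by rewrite lerBrDl sum3.
Qed.

(** As [f] lies in [Y], the [Y']-components [g2] and [h2] coincide. Additivity then bounds
    [|g1| + |g2| + |h1| + |h2|] by [|f| <= |g1| + |h1|], which forces [g2 = 0]. *)
Lemma Lsummand_decomposition (Y : set V) f g h : Lsummand Y -> Y f ->
  f = g - h -> `|g| + `|h| <= `|f| -> Y g /\ Y h.
Proof.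
move=> [[Y0 Yl] _ [Y' [[Y'0 Y'l] dec YY' nYY']]] Yf fgh ghf.
have YB x y : Y x -> Y y -> Y (x - y).
  by move=> Yx Yy; rewrite addrC -scaleN1r; exact: Yl.
have Y'B x y : Y' x -> Y' y -> Y' (x - y).
  by move=> Yx Yy; rewrite addrC -scaleN1r; exact: Y'l.
have [g1 [g2 [Yg1 Yg2 gE]]] := dec g.
have [h1 [h2 [Yh1 Yh2 hE]]] := dec h.
have d0 : g2 - h2 = 0.
  have : (Y `&` Y') (g2 - h2); last by rewrite YY'.
  split; last exact: Y'B.
  have -> : g2 - h2 = f - (g1 - h1).
    by rewrite fgh gE hE (opprD h1 h2) addrACA [RHS]addrC addKr.
  exact: YB Yf (YB _ _ Yg1 Yh1).
have fE : f = g1 - h1 by rewrite fgh gE hE opprD addrACA d0 addr0.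
have g20 : g2 = 0.
  apply/eqP; rewrite -normr_le0.
  have := ler_normB g1 h1; rewrite -fE.
  move: ghf; rewrite gE hE !nYY'//.
  by have := normr_ge0 h2; lra.
have Yg : Y g by rewrite gE g20 addr0.
split=> //; have -> : h = g - f by rewrite fgh opprB addrC subrK.
exact: YB.
Qed.

(** * Closures of cones *)

Lemma closure_normP (A : set V) x :
  closure A x <-> forall e : R, 0 < e -> exists2 a, A a & `|x - a| < e.
Proof.
split=> [clx e e0|H B /nbhs_ballP[e /= e0 eB]].
  have [a [Aa xa]] := clx _ (nbhsx_ballx x e e0).
  by exists a => //; move: xa; rewrite -ball_normE.
have [a Aa xa] := H _ e0; exists a; split=> //.
by apply: eB; rewrite -ball_normE.
Qed.

Lemma cone_closure (C : set V) : cone C -> cone (closure C).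
Proof.
move=> Cc l x y l0 /closure_normP clx /closure_normP cly.
apply/closure_normP => e e0.
have l1 : 0 < l + 1 by rewrite ltr_wpDl.
have d0 : 0 < e / (l + 1) by rewrite divr_gt0.
have [a Ca xa] := clx _ d0; have [b Cb yb] := cly _ d0.
exists (l *: a + b); first exact: Cc.
have -> : l *: x + y - (l *: a + b) = l *: (x - a) + (y - b).
  by rewrite scalerBr opprD addrACA.
rewrite (le_lt_trans (ler_normD _ _))// normrZ (ger0_norm l0).
have -> : e = l * (e / (l + 1)) + e / (l + 1).
  by rewrite -{2}[e / _]mul1r -mulrDl mulrC divfK ?gt_eqF.
by rewrite ler_ltD// ler_wpM2l// ltW.
Qed.

End DualNormed.

(** * Functionals annihilating [W] and order on the quotient *)

Section MidealQuotient.
Context {R : realType} {V : normedModType R}.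
Context (Vp : set V) (W : closed_subspace V).

(** [g] is constant on cosets, so [x] may be replaced by a representative of nearly minimal norm. *)
Lemma annihilator_quotient_norm (g : dual V) x : annihilator W g ->
  `|g x| <= `|g| * `|quotient_map W x|.
Proof.
move=> gW; apply/ler_addgt0Pr => e e0.
have g1 : 0 < `|g| + 1 by rewrite ltr_wpDl.
have [y yx ye] := quotient_norm_adherent (quotient_map W x) (divr_gt0 e0 g1).
have -> : g x = g y.
  by apply/subr0_eq; rewrite -linearB; apply: gW; apply/quotient_mapP.
apply: (le_trans (dual_normP g y)).
apply: (le_trans (ler_wpM2l (normr_ge0 g) (ltW ye))).
rewrite mulrDr lerD2l mulrA ler_pdivrMr// mulrC ler_wpM2l ?(ltW e0)//.
by rewrite lerDl.
Qed.

(** The functional induced by [g] on the quotient is nonnegative on the image of [Vp], hence by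
    continuity on its closure. *)
Lemma annihilator_quotient_le (g : dual V) x y : annihilator W g ->
  (forall x, Vp x -> 0 <= g x) ->
  cone_le (quotient_cone W Vp) (quotient_map W x) (quotient_map W y) ->
  g x <= g y.
Proof.
move=> gW gp /closure_normP xy; apply/ler_addgt0Pr => e e0.
have g1 : 0 < `|g| + 1 by rewrite ltr_wpDl.
have [_ [p Vpp <-] pe] := xy _ (divr_gt0 e0 g1).
have := annihilator_quotient_norm (y - x - p) gW.
rewrite !linearB/= => gle.
have : `|g| * `|quotient_map W y - quotient_map W x - quotient_map W p| <= e.
  apply: (le_trans (ler_wpM2l (normr_ge0 g) (ltW pe))).
  rewrite mulrA ler_pdivrMr// mulrC ler_wpM2l ?(ltW e0)//.
  by rewrite lerDl.
move=> /(le_trans gle); rewrite ler_norml => /andP[+ _].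
by have := gp _ Vpp; lra.
Qed.

(** A norming functional of [q] on the quotient is pulled back along [quotient_map]. *)
Lemma annihilator_norming (q : quotient W) :
  exists f : dual V, [/\ annihilator W f, `|f| <= 1 &
    forall x, quotient_map W x = q -> f x = `|q|].
Proof.
have [F [Fle Fq]] := norming_functional q.
have lF : linear (F \o quotient_map W : V -> R^o).
  by move=> a x y; rewrite /= !linearP.
have Fle' x : (F \o quotient_map W) x <= 1 * `|x|.
  by rewrite mul1r /= (le_trans (Fle _))//; exact: quotient_norm_le.
have [f fE] := dual_of_bounded lF Fle'.
exists f; split=> [x Wx| |x xq]; last by rewrite fE /= xq.
  rewrite fE /=; have -> : quotient_map W x = quotient_map W 0.
    by apply/quotient_mapP; rewrite subr0.
  by rewrite !linear0.
apply: dual_norm_le => x x1.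
have fx z : f z <= `|z| by rewrite fE (le_trans (Fle' z))// mul1r.
rewrite (le_trans _ x1)// ler_norml fx andbT lerNl.
by rewrite -linearN -[leRHS]normrN fx.
Qed.

Lemma Mideal_quotient_O1 (u v w : quotient W) :
  order_smooth_infty_normed Vp -> Mideal W ->
  cone_le (quotient_cone W Vp) u v -> cone_le (quotient_cone W Vp) v w ->
  `|v| <= Num.max `|u| `|w|.
Proof.
move=> VpP MW.
have [x <-] := quotient_map_surj u; have [y yv] := quotient_map_surj v.
have [z <-] := quotient_map_surj w; rewrite -yv => xy yz.
have [f [fW f1 fq]] := annihilator_norming v.
have [g [h [fgh g0 h0 gh]]] := dual_decomposition f VpP.
have [gW hW] := Lsummand_decomposition MW fW fgh gh.
rewrite yv -(fq _ yv).
(* The chain is [f y = g y - h y <= g z - h x <= |g| * |w| + |h| * |u| <= (|g| + |h|) * m <= m],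
   with [m] the maximum of [|u|] and [|w|]. *)
have gyz := annihilator_quotient_le gW g0 yz.
have hxy := annihilator_quotient_le hW h0 xy.
have -> : f y = g y - h y by rewrite fgh.
have gz := le_trans (ler_norm _) (annihilator_quotient_norm z gW).
have := annihilator_quotient_norm x hW; rewrite ler_norml => /andP[hx _].
set m := Num.max _ _.
have m0 : 0 <= m by rewrite le_max normr_ge0.
have gm : `|g| * `|quotient_map W z| <= `|g| * m.
  by rewrite ler_wpM2l// le_max lexx orbT.
have hm : `|h| * `|quotient_map W x| <= `|h| * m.
  by rewrite ler_wpM2l// le_max lexx.
have := ler_wpM2r m0 (le_trans gh f1); rewrite mul1r mulrDl.
by lra.
Qed.

End MidealQuotient.

Theorem proposition4p2 (R : realType) (V : completeNormedModType R)
  (Vp : set V) (W : closed_subspace V) :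
  order_smooth_infty_normed Vp -> Mideal W ->
  order_smooth_infty_normed (quotient_cone W Vp : set (quotient W)).
Proof.
move=> VpP MW.
have Vpc := osi_cone VpP.
have imC x : Vp x -> quotient_cone W Vp (quotient_map W x).
  by move=> Vx; apply: subset_closure; exists x.
have C0 : quotient_cone W Vp 0.
  rewrite -(linear0 (quotient_map W)); apply: imC.
  by have : (Vp `&` (-%R @` Vp)) 0 by [rewrite (osi_proper VpP)]; case.
have O1 u v w := @Mideal_quotient_O1 _ _ _ _ u v w VpP MW.
split.
- apply: cone_closure => l _ _ l0 [x Vx <-] [y Vy <-].
  by exists (l *: x + y); [exact: Vpc|rewrite linearP].
- apply/seteqP; split=> [q [Cq [p Cp pq]]|_ ->]; last first.
    by split=> //; exists 0; rewrite ?oppr0.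
  apply/eqP; rewrite -normr_le0.
  rewrite (le_trans (O1 0 q 0 _ _)) /cone_le ?subr0 ?sub0r -?pq ?opprK//.
    by rewrite pq.
  by rewrite normr0 maxxx.
- move=> q; have [x <-] := quotient_map_surj q.
  have [x1 [x2 [V1 V2 ->]]] := osi_generating VpP x.
  exists (quotient_map W x1), (quotient_map W x2).
  by split; [exact: imC|exact: imC|rewrite linearB].
- exact: closed_closure.
- exact: O1.
(* Half of [e] pays for the choice of a representative, half for its decomposition in [V]. *)
- move=> q e e0; have e20 : 0 < e / 2 by rewrite divr_gt0.
  have [x <- xe] := quotient_norm_adherent q e20.
  have [x1 [x2 [V1 V2 xE]]] := osi_O2 VpP x e20.
  rewrite gt_max => /andP[n1 n2].
  exists (quotient_map W x1), (quotient_map W x2).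
  split; [exact: imC|exact: imC|by rewrite xE linearB|].
  have xe' : `|x| + e / 2 < `|quotient_map W x| + e.
    by rewrite [e in ltRHS]splitr addrA ltrD2r.
  rewrite gt_max; apply/andP; split; apply: le_lt_trans (lt_trans _ xe').
  - exact: quotient_norm_le.
  - exact: n1.
  - exact: quotient_norm_le.
  - exact: n2.
Qed.
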